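(* $C_{\mathbb D}\le 4$. That is, if $C>0$ is a constant such that for every real-valued driving term $u\in\mathrm{Lip}(1/2)$ with $\|u\|_{1/2}<C$ the solution $w(z,t)$ of $$\frac{dw}{dt}=-w\,\frac{e^{iu(t)}+w}{e^{iu(t)}-w},\qquad w(z,0)\equiv z,\quad z\in\mathbb D,$$ maps $\mathbb D$, for each $t>0$ in the time interval considered, onto a domain $\mathbb D\setminus\gamma(t)$, where $\gamma(t)$ is a quasislit, then $C\le4$.
   Context: $\mathbb D=\{z\in\mathbb C:|z|<1\}$. $\mathrm{Lip}(1/2)$ is the class of functions Hölder continuous with exponent $1/2$ on the time interval considered, and $\|u\|_{1/2}$ is the smallest $K$ with $|u(t)-u(s)|\le K|t-s|^{1/2}$ for all $s,t$ in that interval. A quasislit in $\mathbb D$ is a Jordan arc $\gamma$ lying in $\mathbb D$ except for one of its endpoints, which is on $\partial\mathbb D$, such that $\gamma$ is a quasiconformal image of an interval (a quasiarc) and lies within a Stolz angle at its endpoint on $\partial\mathbb D$. $C_{\mathbb D}$ denotes the critical (largest possible) constant $C$ with the property described in the statement. *)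

(* Defs.v *)
From Stdlib Require Import Reals.
From Coquelicot Require Import Coquelicot.

Open Scope R_scope.

(* A nondegenerate interval of nonnegative times starting at 0: one of
   [0,T], [0,T) with T > 0, or [0,+oo). *)
Definition time_interval (I : R -> Prop) : Prop :=
  I 0 /\ (exists T, 0 < T /\ I T) /\
  (forall t, I t -> 0 <= t) /\
  (forall s t, I t -> 0 <= s <= t -> I s).

Definition holder_half_bound (I : R -> Prop) (u : R -> R) (K : R) : Prop :=
  forall s t, I s -> I t -> Rabs (u t - u s) <= K * sqrt (Rabs (t - s)).

Definition Lip_half (I : R -> Prop) (u : R -> R) : Prop :=
  exists K, holder_half_bound I u K.

(* The infimum over K is attained whenever u is in Lip(1/2); otherwise the
   value is p_infty. *)
Definition norm_half (I : R -> Prop) (u : R -> R) : Rbar :=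
  Glb_Rbar (holder_half_bound I u).

Definition unit_disk (z : C) : Prop := Cmod z < 1.
Definition unit_circle (z : C) : Prop := Cmod z = 1.

Definition expi (x : R) : C := (cos x, sin x).

(* Derivative relative to I: two-sided at interior points of I, one-sided at
   an endpoint belonging to I. *)
Definition is_derive_within (I : R -> Prop) (f : R -> C) (t : R) (l : C) : Prop :=
  @filterdiff R_AbsRing R_NormedModule C_R_NormedModule
    f (within I (locally t)) (fun h : R => @scal R_AbsRing C_R_NormedModule h l).

Definition loewner_solution (I : R -> Prop) (u : R -> R) (w : C -> R -> C) : Prop :=
  forall z, unit_disk z ->
    w z 0 = z /\
    forall t, I t ->
      is_derive_within I (w z) t
        (- w z t * ((expi (u t) + w z t) / (expi (u t) - w z t)))%C.

Definition plane_homeomorphism (F : C -> C) : Prop :=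
  exists G : C -> C,
    (forall z, G (F z) = z) /\ (forall z, F (G z) = z) /\
    (forall z, continuous F z) /\ (forall z, continuous G z).

(* Metric definition of quasiconformality: the linear dilatation
     limsup_{r -> 0} max_{|y-x|=r} |F y - F x| / min_{|y-x|=r} |F y - F x|
   is bounded uniformly in x.  Orientation is not imposed: precomposing with
   conjugation does not change the image of a real interval. *)
Definition quasiconformal (F : C -> C) : Prop :=
  plane_homeomorphism F /\
  exists H : R, forall x : C, exists delta : R, 0 < delta /\
    forall r y1 y2, 0 < r < delta ->
      Cmod (y1 - x)%C = r -> Cmod (y2 - x)%C = r ->
      Cmod (F y1 - F x)%C <= H * Cmod (F y2 - F x)%C.

Definition quasiarc (gamma : C -> Prop) : Prop :=
  exists (F : C -> C) (a b : R), quasiconformal F /\ a < b /\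
    forall z, gamma z <-> exists x, a <= x <= b /\ z = F (RtoC x).

(* The nontangential region of aperture M at zeta, together with its vertex. *)
Definition stolz_angle (zeta : C) (M : R) (z : C) : Prop :=
  Cmod (z - zeta)%C <= M * (1 - Cmod z).

Definition jordan_arc (g : R -> C) : Prop :=
  continuous_on (fun s => 0 <= s <= 1) g /\
  (forall s t, 0 <= s <= 1 -> 0 <= t <= 1 -> g s = g t -> s = t).

Definition quasislit (gamma : C -> Prop) : Prop :=
  exists g : R -> C,
    jordan_arc g /\
    (forall z, gamma z <-> exists s, 0 <= s <= 1 /\ z = g s) /\
    unit_circle (g 0) /\
    (forall s, 0 < s <= 1 -> unit_disk (g s)) /\
    quasiarc gamma /\
    (exists M, 1 < M /\ forall z, gamma z -> stolz_angle (g 0) M z).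

Definition maps_onto_slit_disk (f : C -> C) (gamma : C -> Prop) : Prop :=
  forall y, (exists z, unit_disk z /\ f z = y) <-> (unit_disk y /\ ~ gamma y).

(* Main.v *)
Require Import Defs.
From Stdlib Require Import Reals Lra Classical.
From Coquelicot Require Import Coquelicot.
Open Scope R_scope.

(** On the circle, the Loewner equation for the angle [y] of a solution reads
    [y' = cot ((u - y) / 2)].  Solving it for [u] when [y t = a * sqrt t] gives the
    driving term [u t = a * sqrt t + 2 * atan (2 * sqrt t / a)], which is
    Hölder-1/2 with constant [a + 4 / a] and for which [c t = expi (a * sqrt t)]
    is an exact solution.  For a nearby solution [w], the square of [Cmod (w - c)]
    grows like [t ^ (a ^ 2 / 4)].  When [a > 2] this beats [t], so for small [rho]
    the disk of centre [c t] and radius [rho * sqrt t] is invariant backwards in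
    time: a solution found in it at time [t0] started from [1], hence not from a
    point of the unit disk.  The image at time [t0] thus misses all points of the
    unit disk near [c t0], whereas a quasiarc contains no circle.  If [C0 > 4],
    some [a > 2] has [a + 4 / a < C0]. *)

Local Notation is_derive_C := (@is_derive R_AbsRing C_R_NormedModule).

(** * The unit circle *)

Lemma Cmod_expi (x : R) : Cmod (expi x) = 1.
Proof.
  rewrite <- sqrt_1, <- (sin2_cos2 x), Rplus_comm, !Rsqr_pow2. reflexivity.
Qed.

Lemma expi_plus (x y : R) : expi (x + y) = (expi x * expi y)%C.
Proof.
  unfold expi. rewrite cos_plus, sin_plus.
  apply injective_projections; simpl; ring.
Qed.

Lemma expi_plus_PI (x : R) : expi (x + PI) = (- expi x)%C.
Proof. unfold expi. now rewrite neg_cos, neg_sin. Qed.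

Lemma Cmod2_one_minus_Ci (q : R) : Cmod (1 - Ci * q)%C ^ 2 = 1 + q ^ 2.
Proof. rewrite Cmod2_alt. simpl. ring. Qed.

Lemma one_minus_Ci_neq_0 (q : R) : (1 - Ci * q)%C <> 0%C.
Proof. intros E. apply (f_equal Re) in E. simpl in E. lra. Qed.

Lemma expi_double_atan (q : R) : expi (2 * atan q) = ((1 + Ci * q) / (1 - Ci * q))%C.
Proof.
  pose proof (one_minus_Ci_neq_0 q) as Hq.
  assert (Hcos : cos (atan q) ^ 2 * (1 + q ^ 2) = 1).
  { assert (0 < 1 + q ^ 2) by nra.
    rewrite cos_atan, Rsqr_pow2, Rdiv_1_l, pow_inv, pow2_sqrt by lra. field. lra. }
  assert (Hsin : sin (atan q) = q * cos (atan q)).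
  { rewrite sin_atan, cos_atan. unfold Rdiv. ring. }
  replace (expi (2 * atan q)) with (expi (2 * atan q) * (1 - Ci * q) / (1 - Ci * q))%C
    by (field; exact Hq).
  f_equal. unfold expi. rewrite cos_2a, sin_2a, Hsin.
  pose proof (Rmult_eq_compat_l q _ _ Hcos).
  apply injective_projections; simpl; lra.
Qed.

Lemma expi_chord_sqr (y q : R) :
  Cmod (expi (y + 2 * atan q) - expi y)%C ^ 2 = 4 * q ^ 2 / (1 + q ^ 2).
Proof.
  pose proof (one_minus_Ci_neq_0 q) as Hq.
  rewrite expi_plus, expi_double_atan.
  replace (expi y * ((1 + Ci * q) / (1 - Ci * q)) - expi y)%C
    with (expi y * (Ci * RtoC (2 * q)) / (1 - Ci * q))%C
    by (rewrite RtoC_mult; field; exact Hq).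
  rewrite Cmod_div, !Cmod_mult, Cmod_expi, Cmod_Ci, Cmod_R by exact Hq.
  unfold Rdiv. rewrite Rpow_mult_distr, pow_inv, Cmod2_one_minus_Ci, !Rmult_1_l, pow2_abs.
  ring.
Qed.

Lemma unit_circle_neq_0 (e : C) : unit_circle e -> e <> 0%C.
Proof. unfold unit_circle. intros He. apply Cmod_gt_0. lra. Qed.

Lemma Re_Cayley_unit_circle (e c : C) :
  unit_circle e -> unit_circle c -> e <> c -> Re ((e + c) / (e - c))%C = 0.
Proof.
  intros He Hc Hec. apply Cminus_eq_contra in Hec.
  assert (Hpos : 0 < Cmod (e - c)) by now apply Cmod_gt_0.
  apply (Rmult_eq_reg_r (Cmod (e - c) ^ 2)); [|nra].
  rewrite <- re_scal_r, Cmod2_conj.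
  transitivity (Cmod e ^ 2 - Cmod c ^ 2); [|rewrite He, Hc; ring].
  replace ((e + c) / (e - c) * ((e - c) * Cconj (e - c)))%C with ((e + c) * Cconj (e - c))%C
    by (field; exact Hec).
  rewrite !Cmod2_alt. destruct e, c; simpl; ring.
Qed.

Lemma unit_circle_chord_sqr (e c : C) :
  unit_circle e -> unit_circle c -> RtoC (Cmod (e - c) ^ 2) = (- (e - c) ^ 2 / (e * c))%C.
Proof.
  intros He Hc.
  pose proof (unit_circle_neq_0 e He) as He0. pose proof (unit_circle_neq_0 c Hc) as Hc0.
  assert (He2 : (e * Cconj e)%C = 1) by (rewrite <- Cmod2_conj, He; f_equal; ring).
  assert (Hc2 : (c * Cconj c)%C = 1) by (rewrite <- Cmod2_conj, Hc; f_equal; ring).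
  rewrite Cmod2_conj, Cminus_conj.
  transitivity ((e - c) * (c * (e * Cconj e) - e * (c * Cconj c)) / (e * c))%C;
    [field; auto |].
  rewrite He2, Hc2. field. auto.
Qed.

(** * Curves in the plane *)

Lemma is_derive_C_pair (x y : R -> R) (t dx dy : R) :
  is_derive x t dx -> is_derive y t dy ->
  is_derive_C (fun s => (x s, y s)) t (dx, dy).
Proof.
  intros Dx Dy.
  apply (filterdiff_comp'_2 (W := C_R_NormedModule) x y pair t _ _ pair Dx Dy).
  apply (filterdiff_ext (fun z => z)); [now intros [] |].
  apply (filterdiff_ext_lin _ (fun z => z)); [apply filterdiff_id | now intros []].
Qed.

Lemma is_derive_expi_comp (y : R -> R) (t dy : R) :
  is_derive y t dy ->
  is_derive_C (fun s => expi (y s)) t (Ci * dy * expi (y t))%C.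
Proof.
  intros Dy.
  replace (Ci * dy * expi (y t))%C with (dy * - sin (y t), dy * cos (y t))
    by (apply injective_projections; simpl; ring).
  apply is_derive_C_pair;
    [apply (is_derive_comp cos y) | apply (is_derive_comp sin y)]; trivial;
    [apply is_derive_cos | apply is_derive_sin].
Qed.

Lemma is_derive_Cmod_sqr (f : R -> C) (t : R) (df : C) :
  is_derive_C f t df ->
  is_derive (fun s => Cmod (f s) ^ 2) t (2 * Re (Cconj (f t) * df)%C).
Proof.
  intros Df.
  assert (DRe : is_derive (fun s => Re (f s)) t (Re df)).
  { apply (filterdiff_comp' (V := C_R_NormedModule)
      f (fun z : C => fst z) t _ (fun z : C => fst z) Df).
    apply filterdiff_linear, (is_linear_fst (U := R_NormedModule) (V := R_NormedModule)). }
  assert (DIm : is_derive (fun s => Im (f s)) t (Im df)).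
  { apply (filterdiff_comp' (V := C_R_NormedModule)
      f (fun z : C => snd z) t _ (fun z : C => snd z) Df).
    apply filterdiff_linear, (is_linear_snd (U := R_NormedModule) (V := R_NormedModule)). }
  apply (is_derive_ext (fun s => Re (f s) ^ 2 + Im (f s) ^ 2));
    [intros s; now rewrite Cmod2_alt |].
  replace (2 * Re (Cconj (f t) * df)%C)
    with (plus (INR 2 * Re df * Re (f t) ^ 1) (INR 2 * Im df * Im (f t) ^ 1))
    by (change plus with Rplus; unfold Re, Im; simpl; ring).
  apply (is_derive_plus (V := R_NormedModule));
    [now apply (is_derive_pow (fun s => Re (f s))) | now apply (is_derive_pow (fun s => Im (f s)))].
Qed.

Lemma is_filter_lim_within (I : R -> Prop) (t : R) : is_filter_lim (within I (locally t)) t.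
Proof. intros P HP. now apply filter_le_within. Qed.

Lemma is_derive_within_interior (I : R -> Prop) (f : R -> C) (t : R) (l : C) :
  locally t I -> is_derive_within I f t l -> is_derive_C f t l.
Proof.
  intros HI [Hl Hf]. split; [exact Hl |].
  intros x Hx eps. apply (is_filter_lim_locally_unique t x) in Hx. subst x.
  generalize (filter_and _ _ HI (Hf t (is_filter_lim_within I t) eps)).
  apply filter_imp. intros y [Iy Hy]. exact (Hy Iy).
Qed.

Lemma is_derive_within_continuous (I : R -> Prop) (f : R -> C) (t : R) (l : C) :
  is_derive_within I f t l -> filterlim f (within I (locally t)) (locally (f t)).
Proof.
  intros Hf. apply (filterdiff_continuous_aux (V := C_R_NormedModule));
    [eexists; exact Hf | apply is_filter_lim_within].
Qed.

Lemma time_interval_small_times (I : R -> Prop) :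
  time_interval I -> exists t0, 0 < t0 <= 1 /\ forall t, 0 < t <= t0 -> locally t I.
Proof.
  intros (_ & (T & HT & IT) & _ & Idown). exists (Rmin 1 (T / 2)).
  pose proof (Rmin_r 1 (T / 2)).
  split; [split; [apply Rmin_glb_lt; lra | apply Rmin_l] |].
  intros t Ht.
  exists (mkposreal t (proj1 Ht)). intros s Hs. change (Rabs (s - t) < t) in Hs.
  apply Rabs_def2 in Hs. apply (Idown s T IT). lra.
Qed.

Lemma continuous_Cmod (z : C) : continuous Cmod z.
Proof.
  apply (continuous_ext (norm (V := C_R_NormedModule)));
    [intros x; symmetry; apply Cmod_norm | apply (filterlim_norm (V := C_R_NormedModule))].
Qed.

Lemma Cmod_limit_near_circle {T : Type} (F : (T -> Prop) -> Prop) {FF : ProperFilter F}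
  (f c : T -> C) (g : T -> R) (z : C) :
  (forall t, unit_circle (c t)) -> F (fun t => Cmod (f t - c t)%C <= g t) ->
  filterlim g F (locally 0) -> filterlim f F (locally z) -> 1 <= Cmod z.
Proof.
  intros Hc Hnear Hg Hf.
  apply (filterlim_le (F := F) (fun t => 1 - g t) (fun t => Cmod (f t)) 1 (Cmod z)).
  - revert Hnear. apply filter_imp. intros t Ht.
    pose proof (Cmod_triangle (f t) (c t - f t)) as Htri.
    replace (f t + (c t - f t))%C with (c t) in Htri by ring. rewrite (Hc t) in Htri.
    rewrite <- Cmod_opp in Ht. replace (- (f t - c t))%C with (c t - f t)%C in Ht by ring. lra.
  - refine (filterlim_comp _ _ _ g (fun x => 1 - x) _ _ _ Hg _).
    replace (Finite 1) with (Finite (1 - 0)) by (f_equal; ring).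
    apply (continuous_minus (V := R_NormedModule) (fun _ => 1) (fun x => x));
      [apply continuous_const | apply continuous_id].
  - exact (filterlim_comp _ _ _ f Cmod _ _ _ Hf (continuous_Cmod z)).
Qed.

(** * A backward barrier *)

Lemma is_derive_pos_right (f : R -> R) (x l : R) :
  is_derive f x l -> 0 < l -> locally x (fun y : R => x < y -> f x < f y).
Proof.
  intros Df Hl. destruct (proj1 (is_derive_Reals _ _ _) Df l Hl) as [d Hd].
  exists d. intros y Hy Hxy. change R in y. change (Rabs (y - x) < d) in Hy.
  specialize (Hd (y - x) ltac:(lra) Hy). replace (x + (y - x)) with y in Hd by ring.
  apply Rabs_def2 in Hd.
  assert (0 < (f y - f x) / (y - x)) by lra.
  replace (f y) with (f x + (f y - f x) / (y - x) * (y - x)) by (field; lra).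
  assert (0 < (f y - f x) / (y - x) * (y - x)) by (apply Rmult_lt_0_compat; lra). lra.
Qed.

Lemma backward_barrier (f df : R -> R) (a b : R) :
  a <= b ->
  (forall x, a <= x <= b -> is_derive f x (df x)) ->
  (forall x, a <= x <= b -> f x = 0 -> 0 < df x) ->
  f b < 0 -> f a < 0.
Proof.
  intros Hab Df Hzero Hb. apply Rnot_le_lt. intros Ha.
  destruct (completeness (fun x => a <= x <= b /\ 0 <= f x)) as [m [m_ub m_least]].
  { exists b. intros x Hx. lra. }
  { exists a. lra. }
  assert (Hm : a <= m <= b).
  { split; [apply m_ub; lra | apply m_least; intros x Hx; lra]. }
  assert (Cf : continuous f m) by (apply (ex_derive_continuous f); eexists; now apply Df).
  destruct (Rlt_le_dec (f m) 0) as [Hneg | Hnonneg].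
  - destruct (Cf _ (open_lt 0 (f m) Hneg)) as [d Hd].
    assert (m <= m - d); [|pose proof (cond_pos d); lra].
    apply m_least. intros x [Hx Hfx]. apply Rnot_lt_le. intros Hdx.
    assert (x <= m) by now apply m_ub.
    assert (f x < 0) by (apply Hd; change (Rabs (x - m) < d); apply Rabs_def1; lra). lra.
  - assert (Hright : locally m (fun y : R => m < y -> 0 < f y)).
    { destruct Hnonneg as [Hpos | Heq].
      - apply (filter_imp (fun y => 0 < f y)); [now intros | exact (Cf _ (open_gt 0 (f m) Hpos))].
      - apply (filter_imp (fun y => m < y -> f m < f y)); [now rewrite <- Heq |].
        apply (is_derive_pos_right f m (df m)); auto. }
    destruct Hright as [d Hd].
    assert (Hmb : m < b) by (destruct (Req_dec m b); [subst m; lra | lra]).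
    set (y := m + Rmin (d / 2) (b - m)).
    assert (0 < Rmin (d / 2) (b - m)) by (pose proof (cond_pos d); apply Rmin_glb_lt; lra).
    pose proof (Rmin_l (d / 2) (b - m)). pose proof (Rmin_r (d / 2) (b - m)).
    assert (y <= m); [|unfold y in *; lra].
    apply m_ub. split; [unfold y; lra |]. apply Rlt_le, Hd; [|unfold y; lra].
    change (Rabs (y - m) < d). unfold y. apply Rabs_def1; lra.
Qed.

(** * The Loewner vector field near the circle *)

Definition loewner_field (e w : C) : C := (- w * ((e + w) / (e - w)))%C.

Lemma Ci_sqr : (Ci * Ci = - 1)%C.
Proof. apply injective_projections; simpl; ring. Qed.

Lemma loewner_field_expi (y q : R) :
  q <> 0 -> loewner_field (expi (y + 2 * atan q)) (expi y) = (Ci * RtoC (/ q) * expi y)%C.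
Proof.
  intros Hq. pose proof (one_minus_Ci_neq_0 q) as Hden.
  assert (HqC : RtoC q <> 0%C) by (intros E; now apply RtoC_inj in E).
  assert (Hnum : (Ci * Ci * (expi y / (Ci * q)) = Ci * / q * expi y)%C)
    by (field; auto using Ci_nz).
  rewrite RtoC_inv, <- Hnum, Ci_sqr by exact Hq.
  unfold loewner_field. rewrite expi_plus, expi_double_atan.
  assert (Hexpi : expi y <> 0%C) by apply unit_circle_neq_0, Cmod_expi.
  field; repeat split; auto using Ci_nz.
  replace (expi y * (1 + Ci * q) - expi y * (1 - Ci * q))%C with (2 * expi y * (Ci * q))%C by ring.
  repeat apply Cmult_neq_0; auto using Ci_nz. apply Cmod_gt_0. rewrite Cmod_R, Rabs_pos_eq; lra.
Qed.

(* For [e] and [c] on the unit circle the first summand is imaginary: it only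
   rotates [w - c]. *)
Lemma loewner_field_sub (e c w : C) :
  e <> c -> e <> w ->
  (loewner_field e w - loewner_field e c
   = (w - c) * (- ((e + c) / (e - c)) - 2 * w * e / ((e - w) * (e - c))))%C.
Proof.
  intros Hc Hw. unfold loewner_field.
  field; split; now apply Cminus_eq_contra.
Qed.

Definition separation_rate (e c w : C) : R :=
  2 * Re (Cconj (w - c) * (loewner_field e w - loewner_field e c))%C.

Lemma is_derive_Cmod_sqr_sub (e : C) (w c : R -> C) (t : R) :
  is_derive_C w t (loewner_field e (w t)) -> is_derive_C c t (loewner_field e (c t)) ->
  is_derive (fun s => Cmod (w s - c s)%C ^ 2) t (separation_rate e (c t) (w t)).
Proof.
  intros Dw Dc. apply (is_derive_Cmod_sqr (fun s => w s - c s)%C).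
  now apply (is_derive_minus (V := C_R_NormedModule)).
Qed.

Lemma separation_rate_unit_circle (e c w : C) :
  unit_circle e -> unit_circle c -> e <> c -> e <> w ->
  separation_rate e c w
  = 4 * Cmod (w - c) ^ 2 / Cmod (e - c) ^ 2 * Re (w / c * ((e - c) / (e - w)))%C.
Proof.
  intros He Hc Hec Hew.
  assert (Hec0 : (e - c)%C <> 0%C) by now apply Cminus_eq_contra.
  assert (Hew0 : (e - w)%C <> 0%C) by now apply Cminus_eq_contra.
  assert (Hchord : 0 < Cmod (e - c)) by now apply Cmod_gt_0.
  assert (He0 : e <> 0%C) by now apply unit_circle_neq_0.
  assert (Hc0 : c <> 0%C) by now apply unit_circle_neq_0.
  assert (Hsplit : (Cconj (w - c) * (loewner_field e w - loewner_field e c))%C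
    = (RtoC (Cmod (w - c) ^ 2) * (- ((e + c) / (e - c))
        + RtoC (2 / Cmod (e - c) ^ 2) * (w / c * ((e - c) / (e - w)))))%C).
  { rewrite loewner_field_sub, RtoC_div, (unit_circle_chord_sqr e c), Cmod2_conj
      by (trivial; now apply Rgt_not_eq, pow_lt).
    field. auto. }
  unfold separation_rate. rewrite Hsplit, re_scal_l, re_plus, re_opp, re_scal_l.
  rewrite Re_Cayley_unit_circle by assumption. field. lra.
Qed.

Lemma Re_div_near_1_ge (rho : R) (x y : C) :
  rho < 1 -> Cmod x <= rho -> Cmod y <= rho ->
  (1 - 3 * rho) / (1 - rho) <= Re ((1 + x) / (1 - y))%C.
Proof.
  intros Hrho Hx Hy.
  assert (Hden : 1 - rho <= Cmod (1 - y)).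
  { pose proof (Cmod_triangle (1 - y) y) as Htri.
    replace (1 - y + y)%C with (RtoC 1) in Htri by ring. rewrite Cmod_1 in Htri. lra. }
  assert (Hden0 : (1 - y)%C <> 0%C) by (apply Cmod_gt_0; lra).
  assert (Hquot : Cmod ((x + y) / (1 - y)) <= 2 * rho / (1 - rho)).
  { rewrite Cmod_div by exact Hden0. pose proof (Cmod_triangle x y).
    apply Rmult_le_compat; [apply Cmod_ge_0 | | lra | apply Rinv_le_contravar; lra].
    apply Rlt_le, Rinv_0_lt_compat; lra. }
  replace ((1 + x) / (1 - y))%C with (1 + (x + y) / (1 - y))%C by (field; exact Hden0).
  rewrite re_plus, re_RtoC. pose proof (re_le_Cmod ((x + y) / (1 - y))) as Hre.
  apply Rabs_le_between in Hre.
  replace ((1 - 3 * rho) / (1 - rho)) with (1 - 2 * rho / (1 - rho)) by (field; lra). lra.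
Qed.

Lemma separation_rate_ge (e c w : C) (rho : R) :
  unit_circle e -> unit_circle c -> e <> c -> rho < 1 ->
  Cmod (w - c) <= rho -> Cmod (w - c) <= rho * Cmod (e - c) ->
  4 * Cmod (w - c) ^ 2 / Cmod (e - c) ^ 2 * ((1 - 3 * rho) / (1 - rho))
  <= separation_rate e c w.
Proof.
  intros He Hc Hec Hrho Hwc Hwe.
  assert (Hec0 : (e - c)%C <> 0%C) by now apply Cminus_eq_contra.
  assert (Hchord : 0 < Cmod (e - c)) by now apply Cmod_gt_0.
  assert (Hew : e <> w).
  { intros <-. apply (Rlt_irrefl (Cmod (e - c))). eapply Rle_lt_trans; [exact Hwe | nra]. }
  assert (Hc0 : c <> 0%C) by now apply unit_circle_neq_0.
  rewrite separation_rate_unit_circle by assumption.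
  apply Rmult_le_compat_l.
  { apply Rdiv_le_0_compat; [|now apply pow_lt]. pose proof (pow2_ge_0 (Cmod (w - c))). lra. }
  replace (w / c * ((e - c) / (e - w)))%C with ((1 + (w - c) / c) / (1 - (w - c) / (e - c)))%C.
  - apply Re_div_near_1_ge; trivial; rewrite Cmod_div by assumption.
    + rewrite Hc, Rdiv_1_r. exact Hwc.
    + now apply Rle_div_l.
  - assert ((e - w)%C <> 0%C) by now apply Cminus_eq_contra.
    field. repeat split; auto.
Qed.

(** * The driving term *)

Definition boundary_solution (a t : R) : C := expi (a * sqrt t).
Definition boundary_driving (a t : R) : R := a * sqrt t + 2 * atan (2 * sqrt t / a).

Lemma is_derive_boundary_solution (a t : R) :
  0 < a -> 0 < t ->
  is_derive_C (boundary_solution a) t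
    (loewner_field (expi (boundary_driving a t)) (boundary_solution a t)).
Proof.
  intros Ha Ht. pose proof (sqrt_lt_R0 t Ht).
  unfold boundary_driving, boundary_solution. rewrite loewner_field_expi.
  - apply (is_derive_expi_comp (fun s => a * sqrt s)).
    auto_derive; [exact Ht | field; lra].
  - apply Rgt_not_eq, Rdiv_lt_0_compat; lra.
Qed.

Lemma boundary_chord_sqr (a t : R) :
  0 < a -> 0 <= t ->
  Cmod (expi (boundary_driving a t) - boundary_solution a t)%C ^ 2 = 16 * t / (a ^ 2 + 4 * t).
Proof.
  intros Ha Ht. unfold boundary_driving, boundary_solution. rewrite expi_chord_sqr.
  unfold Rdiv. rewrite !Rpow_mult_distr, pow_inv, pow2_sqrt by exact Ht.
  field. pose proof (pow_lt a 2 Ha). nra.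
Qed.

Lemma sqrt_dist_le (x y : R) :
  0 <= x -> 0 <= y -> Rabs (sqrt y - sqrt x) <= sqrt (Rabs (y - x)).
Proof.
  intros Hx Hy. pose proof (sqrt_pos x). pose proof (sqrt_pos y).
  rewrite <- (sqrt_pow2 (Rabs (sqrt y - sqrt x))) by apply Rabs_pos.
  apply sqrt_le_1_alt.
  replace (y - x) with ((sqrt y - sqrt x) * (sqrt y + sqrt x))
    by (pose proof (sqrt_sqrt x Hx); pose proof (sqrt_sqrt y Hy); lra).
  rewrite Rabs_mult, (Rabs_pos_eq (sqrt y + sqrt x)) by lra.
  rewrite <- Rsqr_pow2. apply Rmult_le_compat_l; [apply Rabs_pos | apply Rabs_le; lra].
Qed.

Lemma holder_half_bound_comp_sqrt (I : R -> Prop) (f : R -> R) (K : R) :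
  (forall t, I t -> 0 <= t) -> 0 <= K ->
  (forall x y, Rabs (f y - f x) <= K * Rabs (y - x)) ->
  holder_half_bound I (fun t => f (sqrt t)) K.
Proof.
  intros Ipos HK Hf s t Is It.
  eapply Rle_trans; [apply Hf |].
  apply Rmult_le_compat_l; [exact HK | apply sqrt_dist_le; auto].
Qed.

Lemma holder_half_bound_boundary_driving (I : R -> Prop) (a : R) :
  (forall t, I t -> 0 <= t) -> 0 < a ->
  holder_half_bound I (boundary_driving a) (a + 4 / a).
Proof.
  intros Ipos Ha. assert (Ha4 : 0 < 4 / a) by (apply Rdiv_lt_0_compat; lra).
  apply (holder_half_bound_comp_sqrt I (fun x => a * x + 2 * atan (2 * x / a)));
    [exact Ipos | lra |].
  intros x y.
  apply (bounded_variation (fun s => a * s + 2 * atan (2 * s / a))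
    (fun s => a + 4 / a * / (1 + (2 * s / a)²))).
  intros s _. assert (1 <= 1 + (2 * s / a)²) by (pose proof (Rle_0_sqr (2 * s / a)); lra).
  assert (0 < / (1 + (2 * s / a)²) <= 1).
  { split; [apply Rinv_0_lt_compat; lra |]. rewrite <- Rinv_1. apply Rinv_le_contravar; lra. }
  split; [|rewrite Rabs_pos_eq; nra].
  auto_derive; [trivial |]. unfold Rsqr in *. field. nra.
Qed.

Lemma norm_half_le (I : R -> Prop) (u : R -> R) (K : R) :
  holder_half_bound I u K -> Rbar_le (norm_half I u) (Finite K).
Proof. apply Glb_Rbar_correct. Qed.

Lemma exists_trap_parameters (C0 : R) :
  4 < C0 -> exists a rho, 0 < a <= 3 /\ a + 4 / a < C0 /\
    0 < rho < 1 /\ 4 * (1 - rho) < a ^ 2 * (1 - 3 * rho).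
Proof.
  intros HC. set (a := Rmin 3 (C0 / 2)). exists a, ((a ^ 2 - 4) / (4 * a ^ 2)).
  assert (Ha : 2 < a) by (apply Rmin_glb_lt; lra).
  assert (a <= 3) by apply Rmin_l. assert (a <= C0 / 2) by apply Rmin_r.
  assert (Ha2 : 4 < a ^ 2) by nra.
  assert (4 / a < 2) by (apply Rlt_div_l; lra).
  repeat split; try lra; [apply Rdiv_lt_0_compat; lra | apply Rlt_div_l; lra |].
  apply Rminus_lt.
  replace (4 * (1 - (a ^ 2 - 4) / (4 * a ^ 2)) - a ^ 2 * (1 - 3 * ((a ^ 2 - 4) / (4 * a ^ 2))))
    with (- (a ^ 2 - 4) * (a ^ 2 + 4) / (4 * a ^ 2)) by (field; lra).
  apply Rdiv_neg_pos; nra.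
Qed.

(** * Repulsion from the boundary solution *)

Section Trap.

Variables a rho : R.
Hypothesis Ha : 0 < a <= 3.
Hypothesis Hrho : 0 < rho < 1.
(* The squared distance to the boundary solution grows with exponent
   [a ^ 2 / 4], which drops at most by the factor [(1 - 3 * rho) / (1 - rho)]
   within distance [rho * sqrt t] and must still exceed the exponent 1 of [t]. *)
Hypothesis Hrepel : 4 * (1 - rho) < a ^ 2 * (1 - 3 * rho).

Lemma boundary_solution_repulsion (t : R) (w : C) :
  0 < t <= 1 ->
  Cmod (w - boundary_solution a t)%C = rho * sqrt t ->
  rho ^ 2 < separation_rate (expi (boundary_driving a t)) (boundary_solution a t) w.
Proof.
  intros Ht Hdist.
  pose proof (boundary_chord_sqr a t ltac:(lra) ltac:(lra)) as Hchord.
  set (c := boundary_solution a t) in *. set (e := expi (boundary_driving a t)) in *.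
  assert (Hsqrt : 0 < sqrt t <= 1).
  { split; [now apply sqrt_lt_R0 |]. rewrite <- sqrt_1. now apply sqrt_le_1_alt. }
  assert (Hden : 0 < a ^ 2 + 4 * t <= 16) by nra.
  assert (Hchord_ge : sqrt t <= Cmod (e - c)).
  { rewrite <- (sqrt_pow2 (Cmod (e - c))) by apply Cmod_ge_0.
    apply sqrt_le_1_alt. rewrite Hchord. apply Rle_div_r; nra. }
  assert (Hec : e <> c).
  { intros E. rewrite E in Hchord_ge. replace (c - c)%C with (RtoC 0) in Hchord_ge by ring.
    rewrite Cmod_0 in Hchord_ge. lra. }
  pose proof (separation_rate_ge e c w rho (Cmod_expi _) (Cmod_expi _) Hec) as Hrate.
  rewrite Hdist, Hchord, Rpow_mult_distr, pow2_sqrt in Hrate by lra.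
  specialize (Hrate ltac:(lra) ltac:(nra) ltac:(nra)).
  replace (4 * (rho ^ 2 * t) / (16 * t / (a ^ 2 + 4 * t)) * ((1 - 3 * rho) / (1 - rho)))
    with (rho ^ 2 * ((a ^ 2 + 4 * t) * (1 - 3 * rho) / (4 * (1 - rho)))) in Hrate
    by (field; lra).
  assert (1 < (a ^ 2 + 4 * t) * (1 - 3 * rho) / (4 * (1 - rho)))
    by (apply Rlt_div_r; nra).
  assert (0 < rho ^ 2) by (apply pow_lt; lra). nra.
Qed.

Lemma boundary_solution_trap (t0 : R) (f : R -> C) :
  t0 <= 1 ->
  (forall t, 0 < t <= t0 ->
    is_derive_C f t (loewner_field (expi (boundary_driving a t)) (f t))) ->
  Cmod (f t0 - boundary_solution a t0)%C < rho * sqrt t0 ->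
  forall t, 0 < t <= t0 -> Cmod (f t - boundary_solution a t)%C < rho * sqrt t.
Proof.
  intros Ht0 Df Hin t Ht.
  set (dist := fun s => Cmod (f s - boundary_solution a s)%C).
  assert (Hradius : forall s, 0 < s -> 0 < rho * sqrt s /\ (rho * sqrt s) ^ 2 = rho ^ 2 * s).
  { intros s Hs. rewrite Rpow_mult_distr, pow2_sqrt by lra.
    split; [apply Rmult_lt_0_compat; [lra | now apply sqrt_lt_R0] | reflexivity]. }
  assert (Hbarrier : dist t ^ 2 - rho ^ 2 * t < 0).
  { apply (backward_barrier (fun s => dist s ^ 2 - rho ^ 2 * s)
      (fun s => separation_rate (expi (boundary_driving a s)) (boundary_solution a s) (f s)
        - rho ^ 2) t t0); [lra | | |].
    - intros s Hs. apply (is_derive_minus (V := R_NormedModule)).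
      + apply is_derive_Cmod_sqr_sub; [apply Df | apply is_derive_boundary_solution]; lra.
      + auto_derive; [trivial | ring].
    - intros s Hs Hzero. destruct (Hradius s ltac:(lra)) as [Hpos Hsqr].
      apply Rlt_0_minus, boundary_solution_repulsion; try lra.
      apply Rsqr_inj; [apply Cmod_ge_0 | lra |]. rewrite !Rsqr_pow2. fold (dist s). lra.
    - destruct (Hradius t0 ltac:(lra)) as [Hpos Hsqr]. rewrite <- Hsqr.
      rewrite <- !Rsqr_pow2. apply Rlt_minus, Rsqr_incrst_1; [exact Hin | apply Cmod_ge_0 | lra]. }
  destruct (Hradius t ltac:(lra)) as [Hpos Hsqr].
  apply Rsqr_incrst_0; [rewrite !Rsqr_pow2; fold (dist t); lra | apply Cmod_ge_0 | lra].
Qed.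

Lemma loewner_solution_avoids_disk
  (I : R -> Prop) (t0 : R) (w : C -> R -> C) (z : C) :
  I 0 -> (forall t, 0 < t <= t0 -> locally t I) -> 0 < t0 <= 1 ->
  loewner_solution I (boundary_driving a) w -> unit_disk z ->
  rho * sqrt t0 <= Cmod (w z t0 - boundary_solution a t0)%C.
Proof.
  intros I0 Iint Ht0 Hw Hz. apply Rnot_lt_le. intros Hin.
  destruct (Hw z Hz) as [Hw0 Dw].
  assert (Hright : at_right 0 (fun t => 0 < t <= t0)).
  { exists (mkposreal t0 (proj1 Ht0)). intros t Ht Hpos. change (Rabs (t - 0) < t0) in Ht.
    apply Rabs_def2 in Ht. lra. }
  assert (Hin_all : forall t, 0 < t <= t0 ->
    Cmod (w z t - boundary_solution a t)%C < rho * sqrt t).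
  { apply boundary_solution_trap; [lra | | exact Hin]. intros t Ht.
    apply (is_derive_within_interior I); [now apply Iint |].
    apply Dw, locally_singleton, Iint, Ht. }
  apply (Rlt_not_le _ _ Hz).
  apply (Cmod_limit_near_circle (at_right 0) (w z) (boundary_solution a) (fun t => rho * sqrt t)).
  - intros t. apply Cmod_expi.
  - revert Hright. apply filter_imp. intros t Ht. now apply Rlt_le, Hin_all.
  - apply (filterlim_filter_le_1 (F := locally 0)); [apply filter_le_within |].
    replace 0 with (rho * sqrt 0) at 2 by (rewrite sqrt_0; ring).
    apply (continuous_scal_r rho sqrt), continuous_sqrt.
  - rewrite <- Hw0 at 2.
    apply (filterlim_filter_le_1 (F := within I (locally 0)));
      [|now apply (is_derive_within_continuous _ _ _ _ (Dw 0 I0))].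
    intros P HP. unfold at_right, within in *. generalize (filter_and _ _ Hright HP).
    apply filter_imp. intros t [Ht HPt] Hpos. apply HPt.
    now apply locally_singleton, Iint, Ht.
Qed.

End Trap.

(** * Slits have empty interior *)

Lemma continuous_antipodal_eq (f : R -> R) :
  (forall x, continuous f x) -> f (2 * PI) = f 0 -> exists x, f x = f (x + PI).
Proof.
  intros Cf Hper.
  assert (Cdiff : continuity (fun x => f x - f (x + PI))).
  { intros x. apply continuity_pt_filterlim.
    apply (continuous_minus (V := R_NormedModule) f (fun y => f (y + PI))); [apply Cf |].
    apply (continuous_comp (fun y => y + PI) f); [|apply Cf].
    apply (continuous_plus (V := R_NormedModule) (fun y => y) (fun _ => PI));
      [apply continuous_id | apply continuous_const]. }
  destruct (IVT_cor _ 0 PI Cdiff) as (x & _ & Hx).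
  - left. apply PI_RGT_0.
  - rewrite Rplus_0_l. replace (PI + PI) with (2 * PI) by ring. rewrite Hper.
    pose proof (Rle_0_sqr (f 0 - f PI)). unfold Rsqr in *. lra.
  - exists x. lra.
Qed.

Lemma continuous_circle (c : C) (r x : R) : continuous (fun t => c + r * expi t)%C x.
Proof.
  apply (continuous_plus (V := C_R_NormedModule) (fun _ => c) (fun t => r * expi t)%C);
    [apply continuous_const |].
  apply (continuous_ext (fun t => @scal R_AbsRing C_R_NormedModule r (expi t)));
    [intros t; apply scal_R_Cmult |].
  apply (continuous_scal_r (V := C_R_NormedModule)), (ex_derive_continuous (V := C_R_NormedModule)).
  eexists. apply (is_derive_expi_comp (fun t => t)), (is_derive_id (K := R_AbsRing)).
Qed.

Lemma quasiarc_no_circle (gamma : C -> Prop) (c : C) (r : R) :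
  quasiarc gamma -> 0 < r -> ~ (forall x, gamma (c + r * expi x)%C).
Proof.
  intros (F & a & b & ((G & GF & FG & _ & Gc) & _) & _ & Hgamma) Hr Hcircle.
  set (p := fun x => (c + r * expi x)%C) in Hcircle.
  assert (Greal : forall x, G (p x) = RtoC (Re (G (p x)))).
  { intros x. destruct (proj1 (Hgamma _) (Hcircle x)) as (y & _ & Hy).
    fold (p x) in Hy. now rewrite Hy, GF, re_RtoC. }
  destruct (continuous_antipodal_eq (fun x => Re (G (p x)))) as [x Hx].
  - intros x. apply (continuous_comp (fun y => G (p y)) (fun z : C => fst z)).
    + apply (continuous_comp p G); [apply continuous_circle | apply Gc].
    + apply continuous_fst.
  - unfold p, expi. now rewrite cos_2PI, sin_2PI, cos_0, sin_0.
  - assert (Hp : p x = p (x + PI)).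
    { now rewrite <- (FG (p x)), <- (FG (p (x + PI))), (Greal x), (Greal (x + PI)), Hx. }
    unfold p in Hp. rewrite expi_plus_PI in Hp.
    assert (Hzero : (r * expi x)%C = 0).
    { replace (r * expi x)%C
        with (((c + r * expi x) - (c + r * - expi x)) / 2)%C by (field; exact C1_nz).
      rewrite <- Hp. field. }
    apply (f_equal Cmod) in Hzero.
    rewrite Cmod_mult, Cmod_expi, Cmod_R, Rabs_pos_eq, Cmod_0 in Hzero; lra.
Qed.

Lemma slit_disk_image_near_boundary (f : C -> C) (gamma : C -> Prop) (c : C) (rho : R) :
  quasislit gamma -> maps_onto_slit_disk f gamma -> unit_circle c -> 0 < rho ->
  exists z, unit_disk z /\ Cmod (f z - c)%C < rho.
Proof.
  intros (g & _ & _ & _ & _ & Harc & _) Hmap Hc Hrho. apply NNPP. intros Hnone.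
  set (r := Rmin (1 / 2) (rho / 4)).
  assert (Hr : 0 < r) by (apply Rmin_glb_lt; lra).
  assert (Hr1 : r <= 1 / 2) by apply Rmin_l.
  assert (Hr2 : r <= rho / 4) by apply Rmin_r.
  apply (quasiarc_no_circle gamma (RtoC (1 - 2 * r) * c)%C r Harc Hr). intros x.
  apply NNPP. intros Hx.
  assert (Hpoint : Cmod (r * expi x) = r)
    by (rewrite Cmod_mult, Cmod_expi, Cmod_R, Rabs_pos_eq; lra).
  destruct (proj2 (Hmap (RtoC (1 - 2 * r) * c + r * expi x)%C)) as (z & Hz & Hfz).
  - split; [|exact Hx]. unfold unit_disk. eapply Rle_lt_trans; [apply Cmod_triangle |].
    rewrite Hpoint, Cmod_mult, Hc, Cmod_R, Rabs_pos_eq; lra.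
  - apply Hnone. exists z. split; [exact Hz |]. rewrite Hfz.
    replace (RtoC (1 - 2 * r) * c + r * expi x - c)%C with (r * expi x + RtoC (- (2 * r)) * c)%C
      by (rewrite RtoC_minus, RtoC_opp; ring).
    eapply Rle_lt_trans; [apply Cmod_triangle |].
    rewrite Hpoint, Cmod_mult, Hc, Cmod_R, Rabs_left1; lra.
Qed.

Theorem mainTheorem4 (I : R -> Prop) (hI : time_interval I) (C0 : R) (hC0 : 0 < C0)
  (hC : forall u : R -> R, Lip_half I u -> Rbar_lt (norm_half I u) (Finite C0) ->
    exists w : C -> R -> C, loewner_solution I u w /\
      forall t : R, I t -> 0 < t ->
        exists gamma : C -> Prop,
          quasislit gamma /\ maps_onto_slit_disk (fun z => w z t) gamma) :
  C0 <= 4.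
Proof.
  apply Rnot_lt_le. intros HC.
  destruct (exists_trap_parameters C0 HC) as (a & rho & Ha & HaC & Hrho & Hrepel).
  destruct (time_interval_small_times I hI) as (t0 & Ht0 & Iint).
  destruct hI as (I0 & _ & Ipos & _).
  assert (Hu : holder_half_bound I (boundary_driving a) (a + 4 / a))
    by (apply holder_half_bound_boundary_driving; [exact Ipos | lra]).
  destruct (hC (boundary_driving a)) as (w & Hw & Himage).
  { now exists (a + 4 / a). }
  { apply Rbar_le_lt_trans with (Finite (a + 4 / a)); [now apply norm_half_le | exact HaC]. }
  destruct (Himage t0) as (gamma & Hslit & Hmap);
    [apply locally_singleton, Iint; lra | lra |].
  destruct (slit_disk_image_near_boundary _ gamma (boundary_solution a t0) (rho * sqrt t0)
    Hslit Hmap) as (z & Hz & Hnear); [apply Cmod_expi | |].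
  { apply Rmult_lt_0_compat; [lra | apply sqrt_lt_R0; lra]. }
  apply (Rlt_not_le _ _ Hnear). now apply (loewner_solution_avoids_disk a rho) with I.
Qed.
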